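(* Let $d\ge2$, and let $\mathcal{M}$ be the set of closed (in $\mathbb{R}^d$, hence compact) convex subsets of $\Delta_{++}^{d-1}$ with nonempty interior (relative to $\Delta_{++}^{d-1}$), endowed with the topology of the Hausdorff metric. Let $\sqsupset$ be the relation on $\mathcal{M}$ given by $m_A\sqsupset m_B$ iff for every $u\in\mathcal{U}=\{u\in\mathbb{R}^d:\sum_{i=1}^d u_i=0,\ \|u\|=1\}$, $$\sup_{p\in m_A}u\cdot p>\sup_{p\in m_B}u\cdot p .$$ Then $X\equiv\mathcal{M}$ is locally compact, separable and completely metrizable, and the class $\mathcal{P}$ of all preferences on $\mathcal{M}$ that are Grodal-transitive and strictly monotone with respect to $\sqsupset$ is a closed set (in the closed convergence topology) of locally strict preferences.
   Context: $\Delta_{++}^{d-1}=\{p\in\mathbb{R}^d: p_i>0\ \forall i,\ \sum_i p_i=1\}$ with the Euclidean metric; $\|\cdot\|$ is the Euclidean norm. A preference on $X$ is a complete binary relation on $X$ that is closed as a subset of $X\times X$; transitivity is not required. $x\succ y$ means $x\succeq y$ and not $y\succeq x$. $\succeq$ is locally strict if for all $x\succeq y$ and every neighborhood $V$ of $(x,y)$ in $X\times X$ there is $(x',y')\in V$ with $x'\succ y'$. $\succeq$ is Grodal-transitive if for all $x,y,z,w\in X$, $x\succeq y\succ z\succeq w$ implies $x\succeq w$. $\succeq$ is strictly monotone with respect to a relation $\rhd$ if $x\rhd y$ implies $x\succ y$. Closed convergence: $\succeq_n\to\succeq^*$ means (1) for all $x^*\succeq^* y^*$ there are $(x_n,y_n)\to(x^*,y^*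 )$ with $x_n\succeq_n y_n$ for all $n$; and (2) for every subsequence $\{\succeq_{n_k}\}_k$ and every limit $(x^*,y^* )$ of pairs with $x_{n_k}\succeq_{n_k}y_{n_k}$ for all $k$, $x^*\succeq^*y^*$. For locally compact, separable, completely metrizable $X$ this is convergence in the metrizable closed convergence topology on continuous binary relations (closed subsets of $X\times X$). *)

(* Defs.v *)
(* MathComp-Analysis, over an arbitrary R : realType. *)
From HB Require Import structures.
From mathcomp Require Import all_boot all_order all_algebra.
From mathcomp Require Import all_classical all_reals all_analysis.
From mathcomp Require Import ring lra.

Set Implicit Arguments.
Unset Strict Implicit.
Unset Printing Implicit Defensive.

Import Order.TTheory GRing.Theory Num.Theory.
Import numFieldNormedType.Exports.

Local Open Scope classical_set_scope.
Local Open Scope ring_scope.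

(** * Topological notions *)

Definition separable (X : topologicalType) : Prop :=
  exists2 D : set X, countable D & dense D.

Definition is_distance (R : realType) (X : Type) (dist : X -> X -> R) : Prop :=
  [/\ forall x, dist x x = 0,
      forall x y, dist x y = 0 -> x = y,
      forall x y, dist x y = dist y x &
      forall x y z, dist x z <= dist x y + dist y z].

Definition complete_distance (R : realType) (X : topologicalType)
    (dist : X -> X -> R) : Prop :=
  forall u : nat -> X,
    (forall e, 0 < e -> exists N : nat, forall m n : nat,
       (N <= m)%N -> (N <= n)%N -> dist (u m) (u n) < e) ->
    exists l : X, u @ \oo --> l.

Definition completely_metrizable (R : realType) (X : topologicalType) : Prop :=
  exists dist : X -> X -> R,
    [/\ is_distance dist,
        forall x : X, nbhs x =
          filter_from [set e : R | 0 < e] (fun e => [set y | dist x y < e]) &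
        complete_distance dist].

(** * Closed binary relations and the closed convergence topology *)

Record closed_rel (X : topologicalType) := ClosedRel {
  graph : set (X * X);
  closed_graph : closed graph }.

HB.instance Definition _ (X : topologicalType) := gen_eqMixin (closed_rel X).
HB.instance Definition _ (X : topologicalType) :=
  gen_choiceMixin (closed_rel X).

(* Subbase of the closed convergence (Fell) topology on the closed subsets of
   X * X: the relations missing a given compact set, and the relations meeting
   a given open set. *)
Definition closed_conv_subbase (X : topologicalType) :
    set (set (closed_rel X)) :=
  [set U | (exists2 K : set (X * X), compact K &
              U = [set P : closed_rel X | graph P `&` K = set0]) \/
           (exists2 G : set (X * X), open G &
              U = [set P : closed_rel X | graph P `&` G !=set0])].

HB.instance Definition _ (X : topologicalType) :=
  isSubBaseTopological.Build (closed_rel X) (@closed_conv_subbase X) id.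

(* Sequential closed convergence; for X locally compact, separable and
   completely metrizable, and for nonempty relations, it is convergence in the
   topology above. *)
Definition closed_convergence (X : topologicalType)
    (Pn : nat -> closed_rel X) (P : closed_rel X) : Prop :=
  (forall p : X * X, graph P p ->
     exists2 s : nat -> X * X, (forall n, graph (Pn n) (s n)) & s @ \oo --> p) /\
  (forall (k : nat -> nat) (s : nat -> X * X) (p : X * X),
     {homo k : m n / (m < n)%N} ->
     (forall j, graph (Pn (k j)) (s j)) -> s @ \oo --> p -> graph P p).

(** * Preferences *)

Section preferences.
Variable X : topologicalType.
Implicit Types P : closed_rel X.

Definition weak_pref P (x y : X) : Prop := graph P (x, y).

Definition strict_pref P (x y : X) : Prop :=
  weak_pref P x y /\ ~ weak_pref P y x.

(* Closedness is part of [closed_rel], so completeness is all that remains. *)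
Definition is_preference P : Prop :=
  forall x y, weak_pref P x y \/ weak_pref P y x.

Definition locally_strict P : Prop :=
  forall x y, weak_pref P x y ->
  forall V : set (X * X), nbhs (x, y) V ->
  exists x' y', V (x', y') /\ strict_pref P x' y'.

Definition grodal_transitive P : Prop :=
  forall x y z w, weak_pref P x y -> strict_pref P y z -> weak_pref P z w ->
  weak_pref P x w.

Definition strictly_monotone (gt : X -> X -> Prop) P : Prop :=
  forall x y, gt x y -> strict_pref P x y.

End preferences.

(** * Euclidean space; rows carry the sup norm in the library, whose topology
    is the Euclidean one but whose distance is not *)

Definition dotr (R : realType) (d : nat) (u p : 'rV[R]_d) : R :=
  \sum_(i < d) u 0 i * p 0 i.

Definition enorm (R : realType) (d : nat) (u : 'rV[R]_d) : R :=
  Num.sqrt (\sum_(i < d) u 0 i ^+ 2).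

Definition edist (R : realType) (d : nat) (p q : 'rV[R]_d) : R := enorm (p - q).

Definition open_simplex (R : realType) (d : nat) : set 'rV[R]_d :=
  [set p | (forall i, 0 < p 0 i) /\ \sum_(i < d) p 0 i = 1].

(** * The space of sets of priors *)

Definition is_priors (R : realType) (d : nat) (A : set 'rV[R]_d) : Prop :=
  [/\ A `<=` @open_simplex R d,
      closed A,
      convex_set (A : set (convex_lmodType 'rV[R]_d)) &
      interior (A : set (subspace (@open_simplex R d))) !=set0].

Record priors (R : realType) (d : nat) := Priors {
  priors_set :> set 'rV[R]_d;
  priorsP : is_priors priors_set }.

HB.instance Definition _ (R : realType) (d : nat) := gen_eqMixin (priors R d).
HB.instance Definition _ (R : realType) (d : nat) :=
  gen_choiceMixin (priors R d).

Definition point_dist (R : realType) (d : nat) (p : 'rV[R]_d)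
    (B : set 'rV[R]_d) : R := inf [set edist p b | b in B].

Definition excess (R : realType) (d : nat) (A B : set 'rV[R]_d) : R :=
  sup [set point_dist a B | a in A].

Definition hausdorff_dist (R : realType) (d : nat) (A B : set 'rV[R]_d) : R :=
  Num.max (excess A B) (excess B A).

Section enorm_theory.
Variables (R : realType) (d : nat).
Implicit Types u v w p q : 'rV[R]_d.

Lemma enorm_ge0 u : 0 <= enorm u. Proof. exact: sqrtr_ge0. Qed.

Lemma sumsq_ge0 u : 0 <= \sum_(i < d) u 0 i ^+ 2.
Proof. by apply: sumr_ge0 => i _; exact: sqr_ge0. Qed.

Lemma enorm_sq u : enorm u ^+ 2 = \sum_(i < d) u 0 i ^+ 2.
Proof. by rewrite sqr_sqrtr// sumsq_ge0. Qed.

Lemma enormN u : enorm (- u) = enorm u.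
Proof.
by congr Num.sqrt; apply: eq_bigr => i _; rewrite mxE sqrrN.
Qed.

Lemma enorm0 : enorm (0 : 'rV[R]_d) = 0.
Proof.
rewrite /enorm big1 ?sqrtr0// => i _.
by rewrite mxE expr0n.
Qed.

Lemma normr_le_enorm u i : `|u 0 i| <= enorm u.
Proof.
rewrite -sqrtr_sqr ler_sqrt ?sumsq_ge0//.
rewrite (bigD1 i)//= lerDl; apply: sumr_ge0 => j _; exact: sqr_ge0.
Qed.

Lemma dotr_sq_le u v :
  dotr u v ^+ 2 <= (\sum_(i < d) u 0 i ^+ 2) * (\sum_(i < d) v 0 i ^+ 2).
Proof.
rewrite -subr_ge0 -(pmulr_rge0 _ (ltr0n R 2)).
suff -> : 2 * ((\sum_(i < d) u 0 i ^+ 2) * (\sum_(i < d) v 0 i ^+ 2)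
               - dotr u v ^+ 2) =
    \sum_(i < d) \sum_(j < d) (u 0 i * v 0 j - u 0 j * v 0 i) ^+ 2.
  by apply: sumr_ge0 => i _; apply: sumr_ge0 => j _; exact: sqr_ge0.
have E (f g : 'I_d -> R) : (\sum_i f i) * (\sum_j g j) =
    \sum_i \sum_j f i * g j.
  by rewrite big_distrl; apply: eq_bigr => i _; rewrite big_distrr.
rewrite mulrBr [2 * (_ * _)](_ : _ =
  (\sum_i u 0 i ^+ 2) * (\sum_j v 0 j ^+ 2) +
  (\sum_i v 0 i ^+ 2) * (\sum_j u 0 j ^+ 2)); last by ring.
rewrite expr2 /dotr !E mulr_sumr -sumrN -!big_split /=.
apply: eq_bigr => i _; rewrite mulr_sumr -sumrN -!big_split /=.
by apply: eq_bigr => j _; ring.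
Qed.

Lemma enormD u v : enorm (u + v) <= enorm u + enorm v.
Proof.
rewrite -(ler_pXn2r (n := 2))// ?nnegrE ?addr_ge0 ?enorm_ge0//.
have cs : dotr u v <= enorm u * enorm v.
  apply: le_trans (ler_norm _) _.
  rewrite -(ler_pXn2r (n := 2))// ?nnegrE ?mulr_ge0 ?enorm_ge0//.
  by rewrite real_normK ?num_real// exprMn !enorm_sq dotr_sq_le.
have -> : enorm (u + v) ^+ 2 = enorm u ^+ 2 + 2 * dotr u v + enorm v ^+ 2.
  rewrite !enorm_sq /dotr mulr_sumr -!big_split /=.
  by apply: eq_bigr => i _; rewrite mxE; ring.
by rewrite sqrrD lerD2r lerD2l -[leRHS]mulr_natl ler_pM2l.
Qed.

Lemma edist_ge0 p q : 0 <= edist p q. Proof. exact: enorm_ge0. Qed.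

Lemma edistxx p : edist p p = 0. Proof. by rewrite /edist subrr enorm0. Qed.

Lemma edistC p q : edist p q = edist q p.
Proof. by rewrite /edist -enormN opprB. Qed.

Lemma edist_triangle q p w : edist p w <= edist p q + edist q w.
Proof.
by rewrite /edist (_ : p - w = (p - q) + (q - w)) ?enormD// addrA subrK.
Qed.

Lemma enorm_simplex p : open_simplex p -> enorm p <= 1.
Proof.
move=> [p0 p1]; rewrite -(ler_pXn2r (n := 2))// ?nnegrE ?enorm_ge0//.
rewrite enorm_sq expr1n -[leRHS]p1; apply: ler_sum => i _.
rewrite expr2; apply: ler_piMl; first exact: ltW.
rewrite -[leRHS]p1 (bigD1 i)//= lerDl.
by apply: sumr_ge0 => j _; exact: ltW.
Qed.

Lemma edist_simplex p q : open_simplex p -> open_simplex q -> edist p q <= 2.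
Proof.
move=> /enorm_simplex p1 /enorm_simplex q1.
by apply: le_trans (enormD _ _) _; rewrite enormN (_ : 2 = 1 + 1) ?lerD.
Qed.

End enorm_theory.

Section hausdorff_theory.
Variables (R : realType) (d : nat).
Implicit Types A B C : priors R d.

Lemma priors_neq0 A : (A : set _) !=set0.
Proof.
have [_ _ _ [p Ap]] := priorsP A; exists p.
exact: (@interior_subset (subspace (@open_simplex R d)) _ p Ap).
Qed.

Lemma priors_simplex A p : priors_set A p -> open_simplex p.
Proof. by have [+ _ _ _] := priorsP A; exact. Qed.

Lemma priors_inj A B : (A : set _) = B -> A = B.
Proof.
by case: A B => [A hA] [B hB] /= AB; subst B; congr Priors; exact: Prop_irrelevance.
Qed.

Let lb p (B : set 'rV[R]_d) : has_lbound [set edist p b | b in B].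
Proof. by exists 0 => _ [b _ <-]; exact: edist_ge0. Qed.

Lemma point_dist_le B p b : priors_set B b -> point_dist p B <= edist p b.
Proof. by move=> Bb; apply: ge_inf; [exact: lb|exists b]. Qed.

Lemma point_dist_ge0 B p : 0 <= point_dist p B.
Proof.
apply: lb_le_inf => [|_ [b _ <-]]; last exact: edist_ge0.
by have [b Bb] := priors_neq0 B; exists (edist p b); exists b.
Qed.

Lemma point_dist_le_excess A B a : priors_set A a -> point_dist a B <= excess A B.
Proof.
move=> Aa; apply: ub_le_sup; last by exists a.
exists 2 => _ [x Ax <-]; have [b Bb] := priors_neq0 B.
apply: le_trans (point_dist_le _ Bb) _.
exact: edist_simplex (priors_simplex Ax) (priors_simplex Bb).
Qed.

Lemma excess_le A B (c : R) :
  (forall a, priors_set A a -> point_dist a B <= c) -> excess A B <= c.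
Proof.
move=> h; apply: ge_sup => [|_ [a Aa <-]]; last exact: h.
by have [a Aa] := priors_neq0 A; exists (point_dist a B); exists a.
Qed.

Lemma excess_ge0 A B : 0 <= excess A B.
Proof.
have [a Aa] := priors_neq0 A.
exact: le_trans (point_dist_ge0 B a) (point_dist_le_excess B Aa).
Qed.

Lemma excessxx A : excess A A = 0.
Proof.
apply/eqP; rewrite eq_le excess_ge0 andbT; apply: excess_le => a Aa.
by rewrite -(edistxx a); exact: point_dist_le.
Qed.

Lemma excess_triangle B A C : excess A C <= excess A B + excess B C.
Proof.
apply: excess_le => a Aa.
apply: (@le_trans _ _ (point_dist a B + excess B C)); last first.
  by rewrite lerD2r point_dist_le_excess.
rewrite -lerBlDr; apply: lb_le_inf => [|_ [b Bb <-]].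
  by have [b Bb] := priors_neq0 B; exists (edist a b); exists b.
rewrite lerBlDr -lerBlDl.
apply: le_trans (point_dist_le_excess C Bb).
apply: lb_le_inf => [|_ [c Cc <-]].
  by have [c Cc] := priors_neq0 C; exists (edist b c); exists c.
rewrite lerBlDl; apply: le_trans (edist_triangle b a c).
exact: point_dist_le.
Qed.

Lemma excess0_sub A B : excess A B = 0 -> A `<=` B.
Proof.
move=> AB0 a Aa; have [_ clB _ _] := priorsP B; apply: clB => V.
move=> /(@nbhs_ballP R 'rV[R]_d)[e /= e0 aV].
have : point_dist a B < e.
  by apply: le_lt_trans e0; rewrite -AB0; exact: point_dist_le_excess.
move=> /inf_lt[|_ [b Bb <-] abe].
  by have [b Bb] := priors_neq0 B; exists (edist a b); exists b.
exists b; split => //; apply: aV; split => //= i j; rewrite ord1.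
apply: le_lt_trans abe.
by have := normr_le_enorm (a - b) j; rewrite !mxE.
Qed.

Lemma hausdorff_distxx A : hausdorff_dist A A = 0.
Proof. by rewrite /hausdorff_dist excessxx maxxx. Qed.

Lemma hausdorff_distC A B : hausdorff_dist A B = hausdorff_dist B A.
Proof. by rewrite /hausdorff_dist maxC. Qed.

Lemma hausdorff_dist_eq0 A B : hausdorff_dist A B = 0 -> A = B.
Proof.
move=> AB0; apply: priors_inj; apply/seteqP; split; apply: excess0_sub;
  apply/eqP; rewrite eq_le excess_ge0 andbT -AB0 /hausdorff_dist le_max lexx//.
by rewrite orbT.
Qed.

Lemma hausdorff_dist_triangle B A C :
  hausdorff_dist A C <= hausdorff_dist A B + hausdorff_dist B C.
Proof.
rewrite /hausdorff_dist ge_max; apply/andP; split.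
  by apply: le_trans (excess_triangle B A C) _; rewrite lerD// le_max lexx.
apply: le_trans (excess_triangle B C A) _.
by rewrite addrC lerD// le_max lexx orbT.
Qed.

HB.instance Definition _ := @isMetric.Build R (priors R d)
  (fun A B => hausdorff_dist A B) hausdorff_distxx hausdorff_dist_eq0
  hausdorff_distC hausdorff_dist_triangle.

End hausdorff_theory.

Definition unit_directions (R : realType) (d : nat) : set 'rV[R]_d :=
  [set u : 'rV[R]_d | \sum_(i < d) u 0 i = 0 /\ enorm u = 1].

Definition support_fun (R : realType) (d : nat) (A : set 'rV[R]_d)
    (u : 'rV[R]_d) : R := sup [set dotr u p | p in A].

Definition support_dominates (R : realType) (d : nat) (A B : priors R d) :
    Prop :=
  forall u, unit_directions u -> support_fun B u < support_fun A u.

Definition grodal_monotone_prefs (R : realType) (d : nat) :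
    set (closed_rel (priors R d)) :=
  [set P | [/\ is_preference P, grodal_transitive P &
               strictly_monotone (@support_dominates R d) P]].

(* Main.v *)
Require Import Defs.
From mathcomp Require Import all_boot all_order all_algebra.
From mathcomp Require Import all_classical all_reals all_analysis.
From mathcomp Require Import finmap ring lra.
Import Defs.
Import numFieldNormedType.Exports.
Local Open Scope classical_set_scope.
Local Open Scope ring_scope.

Set Implicit Arguments.
Unset Strict Implicit.
Unset Printing Implicit Defensive.

Import Order.TTheory GRing.Theory Num.Theory.

(** A set of priors near A keeps the coordinates of its points above a fixed
    positive constant and contains a fixed ball of the hyperplane of unit-sum
    vectors: a point of half the ball that is missing from B would give, by
    moving away from its projection onto B, a point of A far from B.  The sets
    with these two properties form a compact space (Blaschke selection), whence
    local compactness.  A locally compact metric becomes complete once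
    [|1/phi x - 1/phi y|] is added to it, where [phi x] is the supremum of the
    radii (at most 1) of the compact closed balls centred at x.

    Support dominance is open, because the gap between two support functions
    attains a positive minimum over the unit directions, and a homothety about
    an interior point of A produces sets arbitrarily near A that dominate A or
    are dominated by it.  Openness together with local compactness lets
    completeness, Grodal transitivity and strict monotonicity pass to limits.
    If A is weakly preferred to B, A' dominates A and B dominates B', then
    Grodal transitivity excludes B' >= A' >> A >= B, as B >> B'; hence
    A' is strictly preferred to B'. *)

(** * Euclidean space *)

Section euclidean.
Variables (R : realType) (d : nat).
Implicit Types (u v p q : 'rV[R]_d) (A B : set 'rV[R]_d).

Lemma dotrC u v : dotr u v = dotr v u.
Proof. by apply: eq_bigr => i _; rewrite mulrC. Qed.

Lemma dotrDr u v p : dotr u (v + p) = dotr u v + dotr u p.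
Proof. by rewrite -big_split; apply: eq_bigr => i _; rewrite mxE mulrDr. Qed.

Lemma dotrZr (k : R) u v : dotr u (k *: v) = k * dotr u v.
Proof. by rewrite mulr_sumr; apply: eq_bigr => i _; rewrite mxE mulrCA. Qed.

Lemma dotrNr u v : dotr u (- v) = - dotr u v.
Proof. by rewrite -scaleN1r dotrZr mulN1r. Qed.

Lemma dotrBr u v p : dotr u (v - p) = dotr u v - dotr u p.
Proof. by rewrite dotrDr dotrNr. Qed.

Lemma dotrr u : dotr u u = enorm u ^+ 2.
Proof. by rewrite enorm_sq; apply: eq_bigr => i _; rewrite expr2. Qed.

Lemma dotr_le u v : dotr u v <= enorm u * enorm v.
Proof.
apply: le_trans (ler_norm _) _.
rewrite -(ler_pXn2r (n := 2))// ?nnegrE ?mulr_ge0 ?enorm_ge0//.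
by rewrite real_normK ?num_real// exprMn !enorm_sq dotr_sq_le.
Qed.

Lemma enormZ (k : R) u : enorm (k *: u) = `|k| * enorm u.
Proof.
rewrite /enorm -sqrtr_sqr -sqrtrM ?sqr_ge0// mulr_sumr; congr Num.sqrt.
by apply: eq_bigr => i _; rewrite mxE exprMn.
Qed.

Lemma enormB_sq u v :
  enorm (u - v) ^+ 2 = enorm u ^+ 2 - 2 * dotr u v + enorm v ^+ 2.
Proof.
rewrite !enorm_sq /dotr mulr_sumr -sumrN -!big_split /=.
by apply: eq_bigr => i _; rewrite !mxE; ring.
Qed.

Lemma enorm_le_sum u : enorm u <= \sum_(i < d) `|u 0 i|.
Proof.
have h0 : 0 <= \sum_(i < d) `|u 0 i| by apply: sumr_ge0.
rewrite -(ler_pXn2r (n := 2))// ?nnegrE ?enorm_ge0// enorm_sq expr2 mulr_suml.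
apply: ler_sum => i _; rewrite -real_normK ?num_real// expr2 ler_wpM2l//.
by rewrite (bigD1 i)//= lerDl; apply: sumr_ge0.
Qed.

Lemma edist_lt_eq0 p q : (forall e : R, 0 < e -> edist p q < e) -> p = q.
Proof.
move=> h; apply/rowP => i; apply/eqP; rewrite -subr_eq0 -normr_eq0.
apply/eqP/le_anti; rewrite normr_ge0 andbT.
apply/ler_addgt0Pr => e /h /ltW e0; rewrite add0r; apply: le_trans e0.
by have := normr_le_enorm (p - q) i; rewrite !mxE.
Qed.

Lemma sum_rowD p q : \sum_i (p + q) 0 i = \sum_i p 0 i + \sum_i q 0 i.
Proof. by rewrite -big_split; apply: eq_bigr => i _; rewrite mxE. Qed.

Lemma sum_rowZ (k : R) p : \sum_i (k *: p) 0 i = k * \sum_i p 0 i.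
Proof. by rewrite mulr_sumr; apply: eq_bigr => i _; rewrite mxE. Qed.

Lemma sum_rowB p q : \sum_i (p - q) 0 i = \sum_i p 0 i - \sum_i q 0 i.
Proof. by rewrite sum_rowD -scaleN1r sum_rowZ mulN1r. Qed.

Lemma nbhs_edistP p (V : set 'rV[R]_d) :
  nbhs p V <-> exists2 e : R, 0 < e & forall q, edist p q < e -> V q.
Proof.
split=> [/(@nbhs_ballP R 'rV[R]_d)[e /= e0 pV]|[e e0 pV]].
  exists e => // q pq; apply: pV; split=> // i j; rewrite ord1.
  apply: le_lt_trans pq.
  by have := normr_le_enorm (p - q) j; rewrite !mxE.
(* The Euclidean norm is at most the sum of [d] coordinates, each below [e / (d + 1)]; the successor
   also covers [d = 0]. *)
apply/(@nbhs_ballP R 'rV[R]_d); exists (e / d.+1%:R) => /=.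
  by rewrite divr_gt0.
move=> q [_ pq]; apply: pV; apply: le_lt_trans (enorm_le_sum _) _.
apply: (@le_lt_trans _ _ (\sum_(i < d) (e / d.+1%:R))).
  by apply: ler_sum => i _; rewrite !mxE ltW//; exact: pq.
rewrite sumr_const card_ord -[_ *+ d]mulr_natr -mulrA gtr_pMr// mulrC.
by rewrite ltr_pdivrMr// mul1r ltr_nat.
Qed.

Lemma edist_lipschitz_continuous (f : 'rV[R]_d -> R) (k : R) :
  (forall p q, f p - f q <= k * edist p q) -> continuous f.
Proof.
move=> fk p; apply/(@cvgrPdist_lt _ _ _ (nbhs p)) => e e0.
apply/nbhs_edistP.
(* Nothing is assumed on the sign of [k], so a positive Lipschitz constant is made from it. *)
have k1 : 0 < `|k| + 1 by rewrite ltr_wpDl.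
exists (e / (`|k| + 1)) => [|q pq]; first by rewrite divr_gt0.
rewrite ltr_pdivlMr// mulrC in pq; apply: le_lt_trans pq.
have h : k * edist p q <= (`|k| + 1) * edist p q.
  by rewrite ler_wpM2r ?edist_ge0// (le_trans (ler_norm k))// lerDl.
rewrite ler_norml lerNl opprB !(le_trans _ h)//.
by rewrite edistC.
Qed.

Lemma edist_continuous p : continuous (edist p).
Proof.
apply: (@edist_lipschitz_continuous _ 1) => x y.
by rewrite mul1r lerBlDr addrC (edistC x); exact: edist_triangle.
Qed.

Lemma dotr_continuous u : continuous (dotr u).
Proof.
apply: (@edist_lipschitz_continuous _ (enorm u)) => x y.
by rewrite -dotrBr dotr_le.
Qed.

Lemma sum_row_continuous : continuous (fun p => \sum_i p 0 i).
Proof.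
rewrite (_ : (fun p => _) = dotr (const_mx 1)); first exact: dotr_continuous.
by apply/funext => p; apply: eq_bigr => i _; rewrite mxE mul1r.
Qed.

Lemma edist_bounded_compact p (k : R) A :
  closed A -> (forall q, A q -> edist p q <= k) -> compact A.
Proof.
move=> clA Ak; apply: bounded_closed_compact => //.
exists (\sum_i `|p 0 i| + k); split=> [|x kx q Aq]; first exact: num_real.
apply/ltW/(le_lt_trans _ kx); rewrite -/(mx_norm q) mx_normrE.
have k0 : 0 <= k by exact: le_trans (edist_ge0 p q) (Ak _ Aq).
apply/bigmax_leP; split=> [|[i j] _ /=]; first by apply: addr_ge0 => //;
  apply: sumr_ge0.
rewrite ord1 -[q _ _](subrK (p 0 j)) addrC.
apply: le_trans (ler_normD _ _) _; apply: lerD.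
  by rewrite (bigD1 j)//= lerDl; apply: sumr_ge0.
apply: le_trans (Ak _ Aq); rewrite edistC.
by have := normr_le_enorm (q - p) j; rewrite !mxE.
Qed.

(** Positivity of the coordinates is left out: it follows as soon as the ball lies in a set of
    priors. *)
Definition cball p (r : R) : set 'rV[R]_d :=
  [set q : 'rV[R]_d | \sum_i q 0 i = 1 /\ edist p q <= r].

Definition convexr A := forall x y (t : R), 0 <= t <= 1 -> A x -> A y ->
  A (t *: x + (1 - t) *: y).

Lemma convexrP A : convex_set (A : set (convex_lmodType 'rV[R]_d)) <-> convexr
  A.
Proof.
split=> [cA x y t /andP[t0 t1] /mem_set Ax /mem_set Ay|cA x y t].
  have t01 : Itv.spec (Itv.num_sem (R:=R)) (Itv.Real `[0, 1]%Z) t.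
    by apply/and3P; split; rewrite ?num_real//= in_itv/= t0 t1.
  by have /set_mem := cA x y (Itv.mk t01) Ax Ay.
by move=> /set_mem Ax /set_mem Ay; apply/mem_set/cA => //; apply/andP; split.
Qed.

(** The simplex is open in the hyperplane of unit-sum vectors, so an interior point relative to it
    is the centre of a ball of that hyperplane. *)
Lemma is_priorsP A : is_priors A <->
  [/\ A `<=` @open_simplex R d, closed A, convexr A &
      exists p (r : R), [/\ \sum_i p 0 i = 1, 0 < r & cball p r `<=` A]].
Proof.
split=> [[AS clA /convexrP cA [p' p'A]]|[AS clA cA [p [r [p1 r0 prA]]]]];
  split=> //.
- have [p pA] : exists p : 'rV[R]_d,
      interior (A : set (subspace (@open_simplex R d))) p by exists p'.
  have Ap : A p by exact: (@interior_subset (subspace _) _ p pA).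
  have [V /nbhs_edistP[e e0 pe] AV] := (nbhs_subspace_ex A (AS _ Ap)).1 pA.
  exists p.
  have [p0 p1] := AS _ Ap.
  have : nbhs p [set q : 'rV[R]_d | forall i, 0 < q 0 i].
    apply: (@filter_forall _ _ (fun i (q : 'rV[R]_d) => 0 < q 0 i) (nbhs p)).
    move=> i.
    have pi := @coord_continuous R 1 d 0 i p.
    exact: cvgr_gt (p 0 i) pi 0 (p0 i).
  move=> /nbhs_edistP[r r0 pr].
  have m0 : 0 < Num.min e r by rewrite lt_min e0.
  exists (Num.min e r / 2); split=> // [|q [q1 pq]]; first by rewrite divr_gt0.
  have : edist p q < Num.min e r.
    by apply: le_lt_trans pq _; rewrite ltr_pdivrMr// ltr_pMr// ltrDl.
  rewrite lt_min => /andP[/pe Vq /pr q0].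
  by have : (V `&` @open_simplex R d) q by []; rewrite -AV => -[].
- exact/convexrP.
- have Ap : A p.
    by apply: prA; split=> //; rewrite edistxx ltW.
  exists p; apply/(nbhs_subspace_ex A (AS _ Ap)).
  (* Adding the complement of the simplex gives a neighbourhood in the whole space with the same
     trace on the simplex. *)
  exists (A `|` ~` @open_simplex R d); last first.
    by rewrite setIUl setICl setU0.
  apply/nbhs_edistP; exists r => // q /ltW pq.
  by have [[_ q1]|nq] := pselect (open_simplex q); [left; exact: prA|right].
Qed.

End euclidean.

(** * The Hausdorff metric on sets of priors *)

Section priors_theory.
Variables (R : realType) (d : nat).
Implicit Types (A B C : priors R d) (p q : 'rV[R]_d).

Lemma nbhs_hausdorffP A (V : set (priors R d)) :
  nbhs A V <-> exists2 e : R, 0 < e & forall B, hausdorff_dist A B < e -> V B.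
Proof.
split=> [/(@nbhs_ballP R (priors R d))[e /= e0 AV]|[e e0 AV]].
  by exists e => // B AB; apply: AV; rewrite ballEmdist.
by apply/(@nbhs_ballP R (priors R d)); exists e.
Qed.

Lemma hausdorff_dist_lt A B (e : R) :
  (hausdorff_dist A B < e) = (excess A B < e) && (excess B A < e).
Proof. by rewrite /hausdorff_dist gt_max. Qed.

Lemma hausdorff_dist_le A B (e : R) :
  (hausdorff_dist A B <= e) = (excess A B <= e) && (excess B A <= e).
Proof. by rewrite /hausdorff_dist ge_max. Qed.

Lemma excess_lt_edist A B (e : R) a : excess A B < e -> priors_set A a ->
  exists2 b, priors_set B b & edist a b < e.
Proof.
move=> ABe Aa; have : point_dist a B < e.
  exact: le_lt_trans (point_dist_le_excess B Aa) ABe.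
move=> /inf_lt[|_ [b Bb <-] abe]; last by exists b.
by have [b Bb] := priors_neq0 B; exists (edist a b); exists b.
Qed.

Lemma excess_le_edist A B (e : R) :
  (forall a, priors_set A a -> exists2 b, priors_set B b & edist a b <= e) ->
  excess A B <= e.
Proof.
move=> h; apply: excess_le => a /h[b Bb]; apply: le_trans.
exact: point_dist_le.
Qed.

Lemma priors_sum A a : priors_set A a -> \sum_i a 0 i = 1.
Proof. by move=> /priors_simplex[]. Qed.

Lemma priors_convex A : convexr A.
Proof. by have /is_priorsP[] := priorsP A. Qed.

Lemma priors_compact A : compact A.
Proof.
have [_ clA _ _] := priorsP A; have [a Aa] := priors_neq0 A.
apply: (@edist_bounded_compact _ _ a 2 _ clA) => q Aq.
exact: edist_simplex (priors_simplex Aa) (priors_simplex Aq).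
Qed.

Lemma priors_coord_lb A :
  exists2 c : R, 0 < c & forall a i, priors_set A a -> c <= a 0 i.
Proof.
have h i : exists c : R, 0 < c /\ forall a, priors_set A a -> c <= a 0 i.
  have [|/= a /set_mem Aa amin] :=
      @EVT_min_rV R d (fun p => p 0 i) A (priors_neq0 A) (@priors_compact A).
    by apply: continuous_subspaceT; exact: coord_continuous.
  exists (a 0 i); split=> [|b Ab]; first by have [] := priors_simplex Aa.
  by apply: amin; exact/mem_set.
have [c /all_and2[c0 cA]] := choice h.
(* The base value 1 keeps the minimum positive for an empty family. *)
exists (\big[Num.min/1]_i c i); first by apply/bigmin_gtP; split.
by move=> a i /(cA i); apply: le_trans; exact: bigmin_le.
Qed.

(** Variational inequality of the projection: [b] minimises the distance to [q], so moving from [b]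
    towards [b'] cannot decrease the squared distance to first order. *)
Lemma nearest_point q B : exists2 b, priors_set B b &
  forall b', priors_set B b' -> dotr (q - b) (b' - b) <= 0.
Proof.
have [|/= b /set_mem Bb bmin] :=
    @EVT_min_rV R d (edist q) B (priors_neq0 B) (@priors_compact B).
  by apply: continuous_subspaceT; exact: edist_continuous.
exists b => // b' Bb'.
set w := q - b; set v := b' - b.
have h (t : R) : 0 < t <= 1 -> 2 * dotr w v <= t * enorm v ^+ 2.
  move=> /andP[t0 t1].
  have Bt : priors_set B (t *: b' + (1 - t) *: b).
    by apply: priors_convex => //; rewrite t1 ltW.
  have := bmin _ (mem_set Bt).
  rewrite -(ler_pXn2r (n := 2))// ?nnegrE ?edist_ge0// /edist.
  rewrite (_ : q - (_ + _) = w - t *: v); last first.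
    by apply/rowP => i; rewrite !mxE; ring.
  rewrite -/w (enormB_sq w) dotrZr enormZ exprMn real_normK ?num_real// => le.
  rewrite -(ler_pM2l t0); lra.
rewrite leNgt; apply/negP => wv0.
(* This [t] makes [t * enorm v ^+ 2] at most [dotr w v], so [h] bounds [2 * dotr w v] by [dotr w v],
   against positivity. The added 1 avoids a zero denominator. *)
pose t := Num.min 1 (dotr w v / (enorm v ^+ 2 + 1)).
have v1 : 0 < enorm v ^+ 2 + 1 by rewrite ltr_wpDl// sqr_ge0.
have t01 : 0 < t <= 1 by rewrite lt_min ltr01 divr_gt0//= ge_min lexx.
have := h _ t01.
have : t * enorm v ^+ 2 <= dotr w v.
  have : t * (enorm v ^+ 2 + 1) <= dotr w v.
    by rewrite -ler_pdivlMr// ge_min lexx orbT.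
  by have /andP[/ltW t0 _] := t01; lra.
lra.
Qed.

Lemma cball_stable A B p (r : R) : \sum_i p 0 i = 1 -> cball p r `<=` A ->
  excess A B < r / 2 -> cball p (r / 2) `<=` B.
Proof.
move=> p1 prA ABr q [q1 pq].
have r0 : 0 < r / 2 by exact: le_lt_trans (excess_ge0 A B) ABr.
have [b Bb bB] := nearest_point q B.
have [/eqP qb|qb] := eqVneq (edist q b) 0.
  suff -> : q = b by [].
  by apply: edist_lt_eq0 => e e0; rewrite (eqP qb).
have s0 : 0 < edist q b by rewrite lt_neqAle eq_sym qb edist_ge0.
(* Moving [q] by [r / 2] away from its projection [b] stays within [r] of [p], hence in A. *)
pose a := q + ((r / 2) / edist q b) *: (q - b).
have /(excess_lt_edist ABr)[b' Bb' ab'] : priors_set A a.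
  apply: prA; split.
    by rewrite sum_rowD sum_rowZ sum_rowB q1 (priors_sum Bb) subrr mulr0 addr0.
  apply: le_trans (edist_triangle q _ _) _.
  suff -> : edist q a = r / 2 by lra.
  rewrite /edist /a opprD addNKr enormN enormZ ger0_norm; last first.
    by rewrite divr_ge0// ltW.
  by rewrite -/(edist q b) mulfVK// gt_eqF.
(* The left side is at least [edist q b ^+ 2 + r / 2 * edist q b] by the projection inequality,
   while [edist a b' < r / 2]: a contradiction. *)
have : dotr (q - b) (a - b') <= edist q b * edist a b' by exact: dotr_le.
rewrite (_ : a - b' = (q - b) - (b' - b) + ((r / 2) / edist q b) *: (q - b));
  last first.
  by apply/rowP => i; rewrite !mxE; ring.
rewrite dotrDr dotrBr dotrZr dotrr -/(edist q b).
have := bB _ Bb'.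
have -> : r / 2 / edist q b * edist q b ^+ 2 = r / 2 * edist q b.
  by field; rewrite gt_eqF.
have : edist q b * edist a b' < edist q b * (r / 2) by rewrite ltr_pM2l.
have : 0 < edist q b ^+ 2 by rewrite exprn_gt0.
lra.
Qed.

End priors_theory.

(** Otherwise the complements of the finitely many fibres would all belong to F, although their
    intersection is empty. *)
Lemma ultra_finite_fiber (T : Type) (I : finType) (f : T -> I)
    (F : set_system T) : UltraFilter F -> exists i, F [set x | f x = i].
Proof.
move=> FU; apply: contrapT => nF.
have /filter_ex[x /(_ (f x))] : \forall x \near F, forall i, ~ (f x = i).
  apply: filter_forall => i.
  by have [Fi|//] := in_ultra_setVsetC [set x | f x = i] FU; case: nF; exists i.
by [].
Qed.

(** * Compactness *)

Section compactness.
Variables (R : realType) (d : nat).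
Implicit Types (A B C : priors R d) (p q : 'rV[R]_d).

(** Index of the grid cube of side [1 / N] containing [p]. For [p] in the simplex the truncation is
    at most [N], so [inord] does not fall back to its default. *)
Definition cell (N : nat) p : {ffun 'I_d -> 'I_N.+1} :=
  [ffun i => inord (Num.truncn (N%:R * p 0 i))].

Lemma cell_edist (N : nat) p q : open_simplex p -> open_simplex q ->
  cell N.+1 p = cell N.+1 q -> edist p q <= d%:R / N.+1%:R.
Proof.
move=> Sp Sq pq; apply: le_trans (enorm_le_sum _) _.
have tr (x : 'rV[R]_d) i : open_simplex x -> exists k : nat,
    [/\ cell N.+1 x i = k :> nat, k%:R <= N.+1%:R * x 0 i &
        N.+1%:R * x 0 i < k%:R + 1].
  move=> [x0 x1]; exists (Num.truncn (N.+1%:R * x 0 i)).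
  have xi0 : 0 <= N.+1%:R * x 0 i by rewrite mulr_ge0// ltW.
  have /andP[h1 h2] := truncn_itv xi0.
  split=> //; last by rewrite natr1.
  rewrite ffunE inordK// ltnS -(ler_nat R); apply: le_trans h1 _.
  rewrite ger_pMr// -[leRHS]x1 (bigD1 i)//= lerDl.
  by apply: sumr_ge0 => j _; rewrite ltW.
have close i : `|(p - q) 0 i| <= N.+1%:R^-1.
  have [k [pk k1 k2]] := tr p i Sp; have [l [ql l1 l2]] := tr q i Sq.
  have kl : k = l by rewrite -pk pq.
  rewrite -div1r ler_pdivlMr// -[X in _ * X]ger0_norm// -normrM !mxE.
  rewrite mulrBl ![_ * N.+1%:R]mulrC ler_norml; rewrite -kl in l1 l2.
  by apply/andP; split; lra.
apply: le_trans (ler_sum _ (fun i _ => close i)) _.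
by rewrite sumr_const card_ord -[_ *+ d]mulr_natl.
Qed.

(* Sets of priors meeting the same cells of a grid of mesh 1/N are close. *)
Lemma finite_pattern (e : R) : 0 < e ->
  exists (T : finType) (f : priors R d -> T),
    forall A B, f A = f B -> hausdorff_dist A B < e.
Proof.
(* With this [N], the bound [d / (N + 1)] on the diameter of a cell is below [e]. *)
move=> e0; pose N := Num.truncn (d%:R / e).
exists {set {ffun 'I_d -> 'I_N.+2}}.
exists (fun A => [set z | `[< exists2 a,
  priors_set A a & cell N.+1 a = z >]]%SET).
have h A B : [set z | `[< exists2 a, priors_set A a & cell N.+1 a = z >]]%SET =
    [set z | `[< exists2 a, priors_set B a & cell N.+1 a = z >]]%SET ->
    excess A B < e.
  move=> /setP AB; apply: (@le_lt_trans _ _ (d%:R / N.+1%:R)).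
    apply: excess_le_edist => a Aa; move: (AB (cell N.+1 a)).
    rewrite !inE => /esym.
    rewrite (introT (asboolP (exists2 a',
      priors_set A a' & cell N.+1 a' = cell N.+1 a))); last by exists a.
    move=> /asboolP[b Bb ba]; exists b => //.
    by apply: cell_edist => //;
      [exact: priors_simplex Aa|exact: priors_simplex Bb].
  rewrite ltr_pdivrMr// mulrC -ltr_pdivrMr//.
  by have /andP[] := truncn_itv (divr_ge0 (ler0n R d) (ltW e0)).
by move=> A B AB; rewrite hausdorff_dist_lt !h.
Qed.

(** The common ball prevents a limit of such sets from losing its interior, and the bound [c]
    prevents it from reaching the boundary of the simplex. *)
Definition fat p (r c : R) : set (priors R d) :=
  [set B : priors R d | cball p r `<=` B /\ forall b i,
    priors_set B b -> c <= b 0 i].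

Lemma simplex_ge_compact (c : R) : 0 < c ->
  compact [set q : 'rV[R]_d | \sum_i q 0 i = 1 /\ forall i, c <= q 0 i].
Proof.
move=> c0; have sS q : \sum_i q 0 i = 1 /\ (forall i,
  c <= q 0 i) -> open_simplex q.
  by move=> [q1 qc]; split=> // i; apply: lt_le_trans (qc i).
have [->|/set0P[x /sS Sx]] := eqVneq [set q : 'rV[R]_d |
    \sum_i q 0 i = 1 /\ forall i, c <= q 0 i] set0; first exact: compact0.
apply: (@edist_bounded_compact _ _ x 2) => [|q /sS Sq];
  last exact: edist_simplex.
rewrite (_ : mkset _ = (fun q : 'rV[R]_d => \sum_i q 0 i) @^-1` [set 1] `&`
    \bigcap_i ((fun q : 'rV[R]_d => q 0 i) @^-1` [set t | c <= t])); last first.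
  apply/seteqP; split=> [q [q1 qc]|q [q1 qc]]; split=> // i.
    by move=> _; exact: qc.
  exact: qc.
apply: closedI.
  apply: closed_comp => [q _|]; first exact: sum_row_continuous.
  exact: closed_eq.
apply: closed_bigI => i _; apply: closed_comp => [q _|]; last exact: closed_ge.
exact: coord_continuous.
Qed.

Lemma fat_compact p (r c : R) : \sum_i p 0 i = 1 -> 0 < r -> 0 < c ->
  compact (fat p r c).
Proof.
move=> p1 r0 c0; rewrite compact_ultra => F FU Ffat.
pose near_set y (e : R) := [set B : priors R d | exists2 b,
  priors_set B b & edist y b < e].
(* The finite patterns make F a Cauchy filter; L is its limit. *)
pose L : set 'rV[R]_d := [set y | forall e : R, 0 < e -> F (near_set y e)].
pose K := [set q : 'rV[R]_d | \sum_i q 0 i = 1 /\ forall i, c <= q 0 i].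
have cK : compact K := simplex_ge_compact c0.
have fatK B b : fat p r c B -> priors_set B b -> K b.
  by move=> [_ Bc] Bb; split=> [|i]; [exact: priors_sum Bb|exact: Bc].
have LK : L `<=` K.
  have clK : closed K := compact_closed (@norm_hausdorff _ _) cK.
  move=> y Ly; apply: clK => V /nbhs_edistP[e e0 yV].
  have [B [Bfat [b Bb yb]]] := filter_ex (filterI Ffat (Ly e e0)).
  by exists b; split; [exact: fatK Bb|exact: yV].
(* Hausdorff closeness to L is expressed pointwise, since L is not yet known to be a set of
   priors. *)
have small (e : R) : 0 < e -> exists2 S : set (priors R d), F S &
    forall B, S B -> [/\ fat p r c B,
      forall y, L y -> exists2 b, priors_set B b & edist y b < e &
      forall b, priors_set B b -> exists2 y, L y & edist b y < e].
  move=> e0; have e20 : 0 < e / 2 by rewrite divr_gt0.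
  have [T [f fP]] := finite_pattern e20.
  have [t Ft] := ultra_finite_fiber f FU.
  pose S := fat p r c `&` [set B | f B = t].
  have FS : F S by exact: filterI.
  have SS B B' : S B -> S B' -> hausdorff_dist B B' < e / 2.
    by move=> [_ Bt] [_ B't]; apply: fP; rewrite Bt.
  exists S => // B SB; split; first by case: SB.
    move=> y Ly; have [B' [SB' [b' Bb' yb']]] :=
      filter_ex (filterI FS (Ly _ e20)).
    have /andP[_ B'B] : (excess B B' < e / 2) && (excess B' B < e / 2).
      by rewrite -hausdorff_dist_lt; exact: SS.
    have [b Bb b'b] := excess_lt_edist B'B Bb'.
    exists b => //; apply: le_lt_trans (edist_triangle b' _ _) _; lra.
  move=> b Bb.
  (* A cluster point of a selection of points near b, one in each member of S,
     is in L because F is an ultrafilter. *)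
  have /choice[g gP] : forall B', exists b',
    S B' -> priors_set B' b' /\ edist b b' < e / 2.
    (* Outside [S] nothing is required, and [b] is a default value. *)
    move=> B'; have [SB'|nSB'] := pselect (S B'); last by exists b.
    have /andP[BB' _] : (excess B B' < e / 2) && (excess B' B < e / 2).
      by rewrite -hausdorff_dist_lt; exact: SS.
    by have [b' Bb' bb'] := excess_lt_edist BB' Bb; exists b'.
  have GK : (g @ F) K.
    have sub : S `<=` g @^-1` K.
      by move=> B' SB'; have [h _] := gP _ SB'; apply: fatK h; case: SB'.
    exact: filterS sub FS.
  have [y [Ky yG]] := cK _ _ GK.
  have meet (E : set (priors R d)) (e' : R) : 0 < e' -> F E ->
      exists B', [/\ S B', E B' & edist y (g B') < e'].
    move=> e'0 FE.
    have GE : (g @ F) (g @` (S `&` E)).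
      have sub : S `&` E `<=` g @^-1` (g @` (S `&` E)) by move=> B' SE;
        exists B'.
      exact: filterS sub (filterI FS FE).
    have ny : nbhs y [set z | edist y z < e'] by apply/nbhs_edistP; exists e'.
    by have [_ [[B' [SB' EB'] <-] yB']] := yG _ _ GE ny; exists B'.
  exists y.
    move=> e' e'0; have [//|nF] := in_ultra_setVsetC (near_set y e') FU.
    have [B' [SB' nB' yB']] := meet _ _ e'0 nF.
    by case: nB'; exists (g B') => //; have [] := gP _ SB'.
  have [B' [SB' _ yB']] := meet _ _ e20 FS.
  have [_ bB'] := gP _ SB'.
  by apply: le_lt_trans (edist_triangle (g B') _ _) _; rewrite (edistC _ y);
    lra.
have Lpriors : is_priors L.
  apply/is_priorsP; split.
  - by move=> y /LK[y1 yc]; split=> // i; apply: lt_le_trans (yc i).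
  - move=> y yL e e0; have e20 : 0 < e / 2 by rewrite divr_gt0.
    have [|z [Lz yz]] := yL [set z | edist y z < e / 2].
      by apply/nbhs_edistP; exists (e / 2).
    apply: filterS (Lz _ e20) => B [b Bb zb]; exists b => //.
    by apply: le_lt_trans (edist_triangle z _ _) _; move: yz => /=; lra.
  - move=> x y t t01 Lx Ly e e0.
    apply: filterS (filterI (Lx _ e0) (Ly _ e0)) => B [[b Bb xb] [b' Bb' yb']].
    exists (t *: b + (1 - t) *: b'); first exact: priors_convex.
    rewrite /edist (_ : _ - _ = t *: (x - b) + (1 - t) *: (y - b')); last first.
      by apply/rowP => i; rewrite !mxE; ring.
    apply: le_lt_trans (enormD _ _) _; rewrite !enormZ.
    have /andP[t0 t1] := t01.
    rewrite !ger0_norm ?subr_ge0// -/(edist _ _) -/(edist _ _).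
    (* Bounding by the maximum keeps the inequality strict even at [t = 0] and [t = 1]. *)
    pose m := Num.max (edist x b) (edist y b').
    have me : m < e by rewrite gt_max xb.
    apply: le_lt_trans me; rewrite (_ : m = t * m + (1 - t) * m); last by ring.
    by rewrite lerD// ler_wpM2l ?subr_ge0// le_max lexx ?orbT.
  - exists p, r; split=> // q qB e e0.
    by apply: filterS Ffat => B [/(_ _ qB) Bq _]; exists q => //;
      rewrite edistxx.
exists (Priors Lpriors); split.
  split=> [q qB|b i /LK[_]//] e e0.
  by apply: filterS Ffat => B [/(_ _ qB) Bq _]; exists q => //; rewrite edistxx.
move=> V /nbhs_hausdorffP[e e0 LV].
have e20 : 0 < e / 2 by rewrite divr_gt0.
have [S FS SP] := small _ e20.
apply: filterS FS => B /SP[_ h1 h2]; apply: LV.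
apply: (@le_lt_trans _ _ (e / 2)); last lra.
rewrite hausdorff_dist_le; apply/andP; split; apply: excess_le_edist.
  by move=> y /h1[b Bb yb]; exists b => //; exact: ltW.
by move=> b /h2[y Ly yb]; exists y => //; exact: ltW.
Qed.

End compactness.

(** * Separability and complete metrizability *)

(** The function [phi] is positive and 1-Lipschitz, so the added term leaves the topology unchanged;
    along a Cauchy sequence it keeps [phi] away from 0, which puts a tail into one compact ball. *)
Lemma locally_compact_completely_metrizable (R : realType) (T : metricType R) :
  (forall x : T, exists2 e : R, 0 < e & compact [set y | mdist x y <= e]) ->
  completely_metrizable R T.
Proof.
move=> lcT.
pose clb (x : T) (e : R) := [set y | mdist x y <= e].
have nbhsP (x : T) V : nbhs x V <->
    exists2 e : R, 0 < e & forall y, mdist x y < e -> V y.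
  split=> [/nbhs_ballP[e /= e0 xV]|[e e0 xV]].
    by exists e => // y xy; apply: xV; rewrite ballEmdist.
  by apply/nbhs_ballP; exists e => // y; rewrite ballEmdist => /xV.
have clb_closed x e : closed (clb x e).
  move=> y xy; apply/ler_addgt0Pr => e' e'0.
  have [|z [/= xz yz]] := xy [set z | mdist y z < e'].
    by apply/nbhsP; exists e'.
  apply: le_trans (metric_triangle x z y) _.
  by rewrite lerD// metric_sym ltW.
have clb_sub x e y e' : mdist x y + e' <= e -> compact (clb x e) ->
    compact (clb y e').
  move=> xye cx; apply: (subclosed_compact _ cx) => // z /= yz; rewrite /clb/=.
  apply: le_trans (metric_triangle x y z) _.
  by apply: le_trans xye; rewrite lerD2l.
(* The cap at 1 keeps the supremum finite even if every closed ball is compact. *)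
pose E x := [set e : R | 0 < e <= 1 /\ compact (clb x e)].
pose phi x := sup (E x).
have Eub x : has_ubound (E x) by exists 1 => e [/andP[]].
have E0 x : E x !=set0.
  have [e e0 ce] := lcT x; exists (Num.min e 1); split.
    by rewrite lt_min e0 ltr01/= ge_min lexx orbT.
  by apply: clb_sub ce; rewrite mdistxx add0r ge_min lexx.
have phi_ge x e : E x e -> e <= phi x by move=> Ee; exact: ub_le_sup.
have phi0 x : 0 < phi x.
  by have [e Ee] := E0 x; apply: lt_le_trans (phi_ge _ _ Ee);
    case: Ee => /andP[].
(* A compact ball of radius [e] about [x] contains the ball of radius [e - mdist x y] about [y]. *)
have phi_lip x y : phi x - phi y <= mdist x y.
  rewrite lerBlDr; apply: ge_sup => // e [/andP[e0 e1] ce].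
  have [exy|xye] := leP e (mdist x y);
    first by rewrite (le_trans exy)// lerDl ltW.
  rewrite -lerBlDl; apply: phi_ge; split.
    by rewrite subr_gt0 xye/= (le_trans _ e1)// gerBl mdist_ge0.
  by apply: clb_sub ce; rewrite addrC subrK.
have phi_compact x e : e < phi x -> compact (clb x e).
  move=> /(sup_gt (E0 x))[e' [_ ce'] ee'].
  by apply: clb_sub ce'; rewrite mdistxx add0r ltW.
pose D x y := mdist x y + `|(phi x)^-1 - (phi y)^-1|.
have le_D x y : mdist x y <= D x y by rewrite lerDl.
exists D; split.
- split=> [x|x y xy|x y|x y z].
  + by rewrite /D mdistxx subrr normr0 addr0.
  + apply: mdist_positivity; apply/eqP; rewrite eq_le mdist_ge0 andbT.
    by rewrite -xy le_D.
  + by rewrite /D metric_sym distrC.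
  + rewrite /D addrACA lerD ?metric_triangle//; exact: ler_distD.
- move=> x; apply/seteqP; split=> V.
    move=> /nbhsP[e e0 xV]; exists e => // y /= xy; apply: xV.
    exact: le_lt_trans (le_D x y) xy.
  move=> [e /= e0 xV]; have e20 : 0 < e / 2 by rewrite divr_gt0.
  have phix : phi y @[y --> x] --> phi x.
    apply/cvgrPdist_lt => e' e'0; apply/nbhsP; exists e' => // y.
    apply: le_lt_trans; rewrite ler_norml phi_lip andbT lerNl opprB metric_sym.
    exact: phi_lip.
  have /cvgrPdist_lt/(_ _ e20)/nbhsP[e' e'0 xe'] : (phi y)^-1 @[y --> x] -->
    (phi x)^-1.
    by apply: cvgV => //; rewrite gt_eqF.
  apply/nbhsP; exists (Num.min (e / 2) e'); first by rewrite lt_min e20.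
  move=> y; rewrite lt_min => /andP[xy /xe' pxy]; apply: xV => /=.
  by rewrite /D; lra.
- move=> u uC.
  have [N uN] := uC 1 ltr01.
  (* From [N] on, [1 / phi (u n)] differs from [1 / phi (u N)] by less than 1, whence
     [phi (u n) > c]. *)
  pose c := ((phi (u N))^-1 + 1)^-1.
  have c0 : 0 < c by rewrite invr_gt0 addr_gt0 ?invr_gt0.
  have cu n : (N <= n)%N -> c < phi (u n).
    move=> Nn; rewrite -[ltRHS]invrK ltf_pV2 ?posrE ?invr_gt0 ?addr_gt0
      ?invr_gt0//.
    have := uN n N Nn (leqnn N).
    have := mdist_ge0 (u n) (u N); rewrite /D.
    have := ler_norm ((phi (u n))^-1 - (phi (u N))^-1).
    lra.
  have [M uM] := uC (c / 2) (divr_gt0 c0 (ltr0n R 2)).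
  (* From [k] on the sequence stays in the ball of radius [c / 2] about [u k], compact because
     [c / 2 < phi (u k)]; a cluster point of a Cauchy sequence is its limit. *)
  pose k := maxn N M.
  have : compact (clb (u k) (c / 2)).
    apply: phi_compact; apply: lt_trans (cu _ (leq_maxl _ _)).
    by rewrite ltr_pdivrMr// ltr_pMr// ltrDl.
  move=> /(_ (u @ \oo) _)[|l [_ ul]].
    exists k => // n /= kn; rewrite /clb/= (le_trans (le_D _ _))// ltW//.
    by apply: uM; [exact: leq_maxr|exact: leq_trans (leq_maxr _ _) kn].
  exists l => V /nbhsP[e e0 lV].
  have e20 : 0 < e / 2 by rewrite divr_gt0.
  have [K uK] := uC _ e20.
  have [||_ [[n /= Kn <-] lun]] :=
    ul (u @` [set n | (K <= n)%N]) [set y | mdist l y < e / 2].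
  + by exists K => // n Kn; exists n.
  + by apply/nbhsP; exists (e / 2).
  exists K => // m /= Km; apply: lV.
  apply: le_lt_trans (metric_triangle l (u n) _) _.
  have := le_lt_trans (le_D (u n) (u m)) (uK n m Kn Km).
  by move: lun => /=; lra.
Qed.

(** * Local compactness and separability of the space of priors *)

Section topology_of_priors.
Variables (R : realType) (d : nat).
Implicit Types (A B C : priors R d) (p q : 'rV[R]_d).

Lemma closed_hausdorff_ball A (e : R) : closed [set B : priors R d |
  hausdorff_dist A B <= e].
Proof.
move=> B AB; apply/ler_addgt0Pr => e' e'0.
have [|C [/= AC BC]] := AB [set C : priors R d | hausdorff_dist B C < e'].
  by apply/nbhs_hausdorffP; exists e'.
apply: le_trans (hausdorff_dist_triangle C A B) _.
by rewrite lerD// hausdorff_distC ltW.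
Qed.

Lemma compact_hausdorff_ball A :
  exists2 e : R, 0 < e & compact [set B : priors R d | hausdorff_dist A B <= e].
Proof.
have /is_priorsP[_ _ _ [p [r [p1 r0 prA]]]] := priorsP A.
have [c c0 cA] := priors_coord_lb A.
have r20 : 0 < r / 2 by rewrite divr_gt0.
have c20 : 0 < c / 2 by rewrite divr_gt0.
have m0 : 0 < Num.min (r / 2) (c / 2) by rewrite lt_min r20.
(* The extra half makes both excesses strictly smaller than [r / 2], which preserves the half ball,
   and than [c / 2], which keeps coordinates above [c / 2]. *)
exists (Num.min (r / 2) (c / 2) / 2) => [|]; first by rewrite divr_gt0.
apply: subclosed_compact (fat_compact p1 r20 c20) _.
  exact: closed_hausdorff_ball.
move=> B /= AB.
have : hausdorff_dist A B < Num.min (r / 2) (c / 2).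
  by apply: le_lt_trans AB _; rewrite ltr_pdivrMr// ltr_pMr// ltrDl.
rewrite hausdorff_dist_lt lt_min => /andP[/andP[ABr _]].
rewrite lt_min => /andP[_ BAc].
split; first exact: cball_stable ABr.
move=> b i Bb; have [a Aa ba] := excess_lt_edist BAc Bb.
have := cA a i Aa; have := normr_le_enorm (b - a) i.
rewrite -/(edist b a) !mxE distrC => h.
have := ler_norm (a 0 i - b 0 i); lra.
Qed.

Lemma priors_locally_compact : locally_compact [set: priors R d].
Proof.
move=> A _; have [e e0 ce] := compact_hausdorff_ball A.
exists [set B : priors R d | hausdorff_dist A B <= e]; last first.
  by split=> //; exact: closed_hausdorff_ball.
apply: filterS (_ : nbhs A [set B : priors R d | hausdorff_dist A B <= e]);
  first by move=> B.
by apply/nbhs_hausdorffP; exists e => // B /ltW.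
Qed.

Lemma priors_completely_metrizable : completely_metrizable R (priors R d).
Proof.
by apply: locally_compact_completely_metrizable => A;
  exact: compact_hausdorff_ball.
Qed.

(** For each mesh, one representative per grid pattern forms a finite net; the union of these nets
    is dense. *)
Lemma priors_separable : separable (priors R d).
Proof.
(* [A0] is the representative of patterns that no set of priors has. *)
have [[A0 _]|noA] := pselect (exists A : priors R d, True); last first.
  by exists set0 => // O [A]; case: noA; exists A.
have net n : exists D : set (priors R d), countable D /\
    forall A, exists2 B, D B & hausdorff_dist A B < n.+1%:R^-1.
  have [//|T [f fP]] := @finite_pattern R d n.+1%:R^-1.
  pose g t := xget A0 [set A : priors R d | f A = t].
  exists (g @` [set: T]); split.
    by apply: finite_set_countable; apply: finite_image; exact: finite_finset.
  move=> A; exists (g (f A)); first by exists (f A).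
  apply: fP; apply/esym.
  by have /(xgetPex A0) : exists B,
    [set B : priors R d | f B = f A] B by exists A.
have [D /all_and2[cD DP]] := choice net.
exists (\bigcup_n D n); first exact: bigcup_countable.
move=> O [A OA] oO.
have /nbhs_hausdorffP[e e0 AO] : nbhs A O by exact: open_nbhs_nbhs.
have [n ne] : exists n, n.+1%:R^-1 < e.
  exists (Num.truncn e^-1); rewrite invf_plt ?posrE//.
  by have /andP[] := truncn_itv (ltW (etrans (invr_gt0 e) e0)).
have [B DB AB] := DP n A.
exists B; split; last by exists n.
by apply: AO; exact: lt_trans ne.
Qed.

End topology_of_priors.

(** * Support functions and homotheties *)

Section support_functions.
Variables (R : realType) (d : nat).
Implicit Types (A B C : priors R d) (c p q u v : 'rV[R]_d).

Lemma dotr_le_support A u a : priors_set A a -> dotr u a <= support_fun A u.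
Proof.
move=> Aa; apply: ub_le_sup; last by exists a.
exists (enorm u) => _ [b Ab <-]; apply: le_trans (dotr_le _ _) _.
by rewrite ler_piMr ?enorm_ge0// enorm_simplex//; exact: priors_simplex Ab.
Qed.

Lemma support_le A u (k : R) :
  (forall a, priors_set A a -> dotr u a <= k) -> support_fun A u <= k.
Proof.
move=> h; apply: ge_sup => [|_ [a Aa <-]]; last exact: h.
by have [a Aa] := priors_neq0 A; exists (dotr u a); exists a.
Qed.

Lemma support_continuous A : continuous (fun u => support_fun A u).
Proof.
apply: (@edist_lipschitz_continuous _ _ _ 1) => u v; rewrite mul1r lerBlDr.
apply: support_le => a Aa.
rewrite -{1}[u](subrK v) dotrC dotrDr !(dotrC a) lerD ?dotr_le_support//.
apply: le_trans (dotr_le _ _) _.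
by rewrite /edist ler_piMr ?enorm_ge0// enorm_simplex//;
  exact: priors_simplex Aa.
Qed.

Lemma support_le_excess A B u (e : R) : enorm u = 1 -> excess A B < e ->
  support_fun A u <= support_fun B u + e.
Proof.
move=> u1 ABe; apply: support_le => a /(excess_lt_edist ABe)[b Bb ab].
rewrite -[a](subrK b) dotrDr addrC lerD ?dotr_le_support//.
by apply: le_trans (dotr_le _ _) _; rewrite u1 mul1r ltW.
Qed.

Lemma unit_directions_compact : compact (@unit_directions R d).
Proof.
have enorm_cont : continuous (@enorm R d).
  apply: (@edist_lipschitz_continuous _ _ _ 1) => u v; rewrite mul1r lerBlDr.
  by rewrite -{1}[u](subrK v); exact: enormD.
apply: (@edist_bounded_compact _ _ 0 1) => [|u [_ u1]]; last first.
  by rewrite /edist sub0r enormN u1.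
rewrite (_ : @unit_directions R d =
    (fun q : 'rV[R]_d => \sum_i q 0 i) @^-1` [set 0] `&`
    @enorm R d @^-1` [set 1])//.
apply: closedI; (apply: closed_comp => [q _|]; last exact: closed_eq).
  exact: sum_row_continuous.
exact: enorm_cont.
Qed.

Lemma support_dominates_open A B : support_dominates A B ->
  exists2 e : R, 0 < e & forall A' B', hausdorff_dist A A' < e ->
    hausdorff_dist B B' < e -> support_dominates A' B'.
Proof.
(* Without unit directions there is no minimal gap to take, and domination is vacuous. *)
move=> AB; have [U0|/set0P U0] := eqVneq (@unit_directions R d) set0.
  by exists 1 => // A' B' _ _ u; rewrite U0.
have [|/= v /set_mem Uv vmin] := @EVT_min_rV R d
    (fun u => support_fun A u - support_fun B u) _ U0 unit_directions_compact.
  apply: continuous_subspaceT => u.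
  exact: cvgB (@support_continuous A u) (@support_continuous B u).
pose m := support_fun A v - support_fun B v.
have m0 : 0 < m by rewrite subr_gt0; exact: AB.
(* Each of the two support functions changes the gap by at most [m / 3], so at least [m / 3]
   remains. *)
exists (m / 3) => [|A' B']; first by rewrite divr_gt0.
rewrite !hausdorff_dist_lt => /andP[AA' _] /andP[_ B'B] u Uu.
have [_ u1] := Uu.
have := support_le_excess u1 AA'; have := support_le_excess u1 B'B.
have := vmin _ (mem_set Uu); rewrite -/m; lra.
Qed.

(** * Homothetic images of sets of priors *)

Lemma homothetyK c (s : R) q : s != 0 ->
  c + s *: (c + s^-1 *: (q - c) - c) = q.
Proof.
move=> s0; rewrite [c + s^-1 *: _]addrC addrK scalerA mulfV// scale1r.
by rewrite addrC subrK.
Qed.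

Lemma homothetyVK c (s : R) q : s != 0 ->
  c + s^-1 *: (c + s *: (q - c) - c) = q.
Proof. by move=> s0; rewrite -{2}[s]invrK homothetyK// invr_eq0. Qed.

(** Describing the image through the inverse homothety makes it a preimage, which inherits
    closedness and convexity. Inclusion in the simplex can fail for [s > 1] and is assumed. *)
Lemma homothety_priors A c (r s : R) : \sum_i c 0 i = 1 -> 0 < r ->
  cball c r `<=` A -> 0 < s ->
  (forall a, priors_set A a -> open_simplex (c + s *: (a - c))) ->
  exists B : priors R d,
    forall q, priors_set B q <-> priors_set A (c + s^-1 *: (q - c)).
Proof.
move=> c1 r0 crA s0 AS.
pose B : set 'rV[R]_d := [set q | priors_set A (c + s^-1 *: (q - c))].
have s_neq0 : s != 0 by rewrite gt_eqF.
have Bpriors : is_priors B; last by exists (Priors Bpriors).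
apply/is_priorsP; split.
- by move=> q /AS; rewrite homothetyK.
- move=> q Bq; have [_ clA _ _] := priorsP A; apply: clA.
  move=> V /nbhs_edistP[e e0 qV].
  have [|q' [/= Bq' qq']] := Bq [set q' | edist q q' < s * e].
    by apply/nbhs_edistP; exists (s * e) => //; rewrite mulr_gt0.
  exists (c + s^-1 *: (q' - c)); split=> //; apply: qV.
  rewrite /edist (_ : _ - _ = s^-1 *: (q - q')); last first.
    by apply/rowP => i; rewrite !mxE; ring.
  by rewrite enormZ gtr0_norm ?invr_gt0// mulrC ltr_pdivrMr// mulrC.
- move=> x y t t01 Bx By; rewrite /B/= (_ : c + _ =
      t *: (c + s^-1 *: (x - c)) + (1 - t) *: (c + s^-1 *: (y - c))).
    exact: priors_convex.
  by apply/rowP => i; rewrite !mxE; ring.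
- exists c, (s * r); split=> [//||q [q1 cq]]; first by rewrite mulr_gt0.
  apply: crA; split.
    by rewrite sum_rowD sum_rowZ sum_rowB q1 c1 subrr mulr0 addr0.
  rewrite /edist opprD addNKr enormN enormZ gtr0_norm ?invr_gt0//.
  by rewrite mulrC ler_pdivrMr// mulrC -/(edist q c) edistC.
Qed.

(** The point [a] moves by [(s - 1) *: (a - c)], and the simplex has diameter at most 2. *)
Lemma homothety_dist A B c (s : R) : open_simplex c -> 0 < s ->
  (forall q, priors_set B q <-> priors_set A (c + s^-1 *: (q - c))) ->
  hausdorff_dist A B <= 2 * `|s - 1|.
Proof.
move=> Sc s0 BA; have s_neq0 : s != 0 by rewrite gt_eqF.
have close a : priors_set A a -> edist a (c + s *: (a - c)) <= 2 * `|s - 1|.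
  move=> Aa; rewrite /edist (_ : _ - _ = (1 - s) *: (a - c)); last first.
    by apply/rowP => i; rewrite !mxE; ring.
  rewrite enormZ mulrC distrC ler_wpM2r// -/(edist a c).
  exact: edist_simplex (priors_simplex Aa) Sc.
rewrite hausdorff_dist_le; apply/andP; split; apply: excess_le_edist.
  move=> a Aa; exists (c + s *: (a - c)); last exact: close.
  by apply/BA; rewrite homothetyVK.
move=> q /BA Aq; exists (c + s^-1 *: (q - c)) => //; rewrite edistC.
by have := close _ Aq; rewrite homothetyK.
Qed.

(** The point [c + r *: u] is in the ball because [u] has zero sum, and its product with [u] exceeds
    that of [c] by [r]. *)
Lemma support_gt_center A c (r : R) u : 0 < r -> cball c r `<=` A ->
  \sum_i c 0 i = 1 -> unit_directions u -> dotr u c < support_fun A u.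
Proof.
move=> r0 crA c1 [u0 u1].
apply: (@lt_le_trans _ _ (dotr u (c + r *: u))).
  by rewrite dotrDr dotrZr dotrr u1 expr1n mulr1 ltrDl.
apply: dotr_le_support; apply: crA; split.
  by rewrite sum_rowD sum_rowZ u0 mulr0 addr0.
by rewrite /edist opprD addNKr enormN enormZ u1 mulr1 gtr0_norm.
Qed.

Lemma exists_dominating A (e : R) : 0 < e ->
  exists2 B : priors R d, hausdorff_dist A B < e & support_dominates B A.
Proof.
move=> e0; have /is_priorsP[_ _ _ [c [r [c1 r0 crA]]]] := priorsP A.
have Ac : priors_set A c by apply: crA; split=> //; rewrite edistxx ltW.
have Sc := priors_simplex Ac.
have [k k0 kA] := priors_coord_lb A.
(* The Hausdorff displacement is at most [2 * t], hence at most [e / 2]; the bound [k / 2] serves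
   the positivity of coordinates. *)
pose t := Num.min (e / 4) (k / 2).
have t0 : 0 < t by rewrite lt_min !divr_gt0.
have te : t <= e / 4 by rewrite ge_min lexx.
have tk : t <= k / 2 by rewrite ge_min lexx orbT.
have s0 : 0 < 1 + t by rewrite addr_gt0.
(* The homothety of ratio 1 + t > 1 lowers a coordinate by at most t < k. *)
have [a Aa|B BA] := homothety_priors c1 r0 crA s0.
  split=> [i|]; last first.
    by rewrite sum_rowD sum_rowZ sum_rowB c1 (priors_sum Aa) subrr mulr0 addr0.
  have ci1 : c 0 i <= 1.
    rewrite -c1 (bigD1 i)//= lerDl; apply: sumr_ge0 => j _.
    by have [h _] := Sc; rewrite ltW.
  have ai := kA a i Aa; rewrite !mxE.
  have : 0 <= t * a 0 i by rewrite mulr_ge0 ?(ltW t0)// (le_trans _ ai)// ltW.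
  have : t * c 0 i <= t by rewrite ler_piMr// ltW.
  lra.
exists B.
  apply: le_lt_trans (homothety_dist Sc s0 BA) _.
  by rewrite addrAC subrr add0r gtr0_norm//; lra.
move=> u Uu; have cA := support_gt_center r0 crA c1 Uu.
(* The homothety multiplies the height of the support function above the centre, which is positive,
   by [1 + t]. *)
suff : support_fun A u <= dotr u c + (support_fun B u - dotr u c) / (1 + t).
  have : (support_fun A u - dotr u c) * (1 + t) > support_fun A u - dotr u c.
    by rewrite ltr_pMr ?subr_gt0// ltrDl.
  by rewrite -lerBlDl ler_pdivlMr//; lra.
apply: support_le => a Aa; rewrite -lerBlDl ler_pdivlMr//.
rewrite -dotrBr mulrC -dotrZr lerBrDl -dotrDr.
by apply: dotr_le_support; apply/BA; rewrite homothetyVK// gt_eqF.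
Qed.

Lemma exists_dominated A (e : R) : 0 < e ->
  exists2 B : priors R d, hausdorff_dist A B < e & support_dominates A B.
Proof.
move=> e0; have /is_priorsP[_ _ _ [c [r [c1 r0 crA]]]] := priorsP A.
have Ac : priors_set A c by apply: crA; split=> //; rewrite edistxx ltW.
have Sc := priors_simplex Ac.
pose t := Num.min (e / 4) (1 / 2).
have t0 : 0 < t by rewrite lt_min !divr_gt0.
have te : t <= e / 4 by rewrite ge_min lexx.
have t1 : t <= 1 / 2 by rewrite ge_min lexx orbT.
have s0 : 0 < 1 - t by lra.
have [a Aa|B BA] := homothety_priors c1 r0 crA s0.
  apply: (@priors_simplex _ _ A).
  (* With a ratio below 1 the image point is a convex combination of [a] and [c], so it stays in
     A. *)
  rewrite (_ : c + _ = (1 - t) *: a + (1 - (1 - t)) *: c); last first.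
    by apply/rowP => i; rewrite !mxE; ring.
  by apply: priors_convex => //; apply/andP; split; lra.
exists B.
  apply: le_lt_trans (homothety_dist Sc s0 BA) _.
  by rewrite addrAC subrr add0r normrN gtr0_norm//; lra.
move=> u Uu; have cA := support_gt_center r0 crA c1 Uu.
suff : support_fun B u <= dotr u c + (1 - t) * (support_fun A u - dotr u c).
  have : (1 - t) * (support_fun A u - dotr u c) < support_fun A u - dotr u c.
    by rewrite gtr_pMl ?subr_gt0// gtrBl.
  lra.
apply: support_le => q /BA /(dotr_le_support u).
rewrite dotrDr dotrZr dotrBr -lerBrDl mulrC ler_pdivrMr// mulrC.
by rewrite lerBlDl.
Qed.

End support_functions.

(** * Limits of preferences *)

Lemma closed_conv_subbase_open (X : topologicalType)
    (U : set (closed_rel X)) : closed_conv_subbase U -> open U.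
Proof.
move=> sU; exists [set U]; last by rewrite bigcup_set1.
move=> _ ->; exists [fset U]%fset; last by rewrite set_fset1 bigcap_set1.
by move=> V /fset1P ->; exact/mem_set.
Qed.

Section closed_class.
Variables (X : topologicalType) (gt : X -> X -> Prop).
Hypothesis gt_open : forall x y : X, gt x y ->
  exists Vx Vy, [/\ nbhs x Vx, nbhs y Vy &
    forall x' y', Vx x' -> Vy y' -> gt x' y'].
Implicit Types P Q : closed_rel X.

(** At [support_dominates] this is [grodal_monotone_prefs] by conversion. *)
Definition monotone_class : set (closed_rel X) :=
  [set P | [/\ is_preference P, grodal_transitive P & strictly_monotone gt P]].

Lemma nbhs_graph_meet P (p : X * X) (V : set (X * X)) : graph P p ->
  nbhs p V -> nbhs P [set Q | graph Q `&` V !=set0].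
Proof.
move=> Pp; rewrite nbhsE => -[G [oG Gp] GV].
apply: (@filterS _ _ _ [set Q | graph Q `&` G !=set0]).
  by move=> Q [q [Qq Gq]]; exists q; split=> //; exact: GV.
apply: open_nbhs_nbhs; split; last by exists p.
by apply: closed_conv_subbase_open; right; exists G.
Qed.

(** Missing a compact set is a subbasic open condition, so a compact rectangle around the missing
    pair is missed by all relations near P. *)
Lemma nbhs_graph_avoid P (x y : X) :
  (forall (x : X) V, nbhs x V -> exists K, [/\ nbhs x K,
    compact K & K `<=` V]) ->
  ~ graph P (x, y) -> exists Kx Ky, [/\ nbhs x Kx, nbhs y Ky &
    nbhs P [set Q | forall x' y', Kx x' -> Ky y' -> ~ graph Q (x', y')]].
Proof.
move=> lcX nPxy.
have : nbhs (x, y) (~` graph P).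
  by apply: open_nbhs_nbhs; split=> //; exact/closed_openC/closed_graph.
move=> [[/= Vx Vy] [xVx yVy] VP].
have [Kx [xKx cKx KVx]] := lcX _ _ xVx.
have [Ky [yKy cKy KVy]] := lcX _ _ yVy.
exists Kx, Ky; split=> //.
apply: (@filterS _ _ _ [set Q | graph Q `&` (Kx `*` Ky) = set0]).
  move=> Q QK x' y' Kx' Ky' Qxy.
  by have : (graph Q `&` (Kx `*` Ky)) (x', y') by []; rewrite QK.
apply: open_nbhs_nbhs; split.
  apply: closed_conv_subbase_open; left; exists (Kx `*` Ky) => //.
  exact: compact_setX.
rewrite /= -subset0 => -[x' y'] [Pxy [/= /KVx Vx' /KVy Vy']].
by apply: (VP (x', y')).
Qed.

(** A failure at P involves finitely many pairs in or off the graph; nearby relations meet or miss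
    neighbourhoods of these pairs, so a member of the class would fail too. *)
Lemma monotone_class_closed :
  (forall (x : X) V, nbhs x V -> exists K, [/\ nbhs x K,
    compact K & K `<=` V]) ->
  closed monotone_class.
Proof.
move=> lcX P clP.
have complete : is_preference P.
  move=> x y; apply: contrapT => /not_orP[nxy nyx].
  have [Kx [Ky [xK yK PK]]] := nbhs_graph_avoid lcX nxy.
  have [Ly [Lx [yL xL PL]]] := nbhs_graph_avoid lcX nyx.
  have [Q [[Qc _ _] [QK QL]]] := clP _ (filterI PK PL).
  by have [] := Qc x y; [apply: QK|apply: QL]; exact: nbhs_singleton.
split=> //.
- move=> x y z w xy [yz nzy] zw; apply: contrapT => nxw.
  have [Kx [Kw [xK wK PK]]] := nbhs_graph_avoid lcX nxw.
  have [Kz [Ky [zK yK PL]]] := nbhs_graph_avoid lcX nzy.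
  have xyK : nbhs (x, y) (Kx `*` Ky) by exists (Kx, Ky).
  have zwK : nbhs (z, w) (Kz `*` Kw) by exists (Kz, Kw).
  (* Q meets the rectangles at [(x, y)] and [(z, w)] at points not controlled further; whole
     rectangles at [(x, w)] and [(z, y)] are missed, so any such points contradict Grodal
     transitivity of Q. *)
  have [Q [[Qc Qg _] [[QK QL] [QM QN]]]] :=
    clP _ (filterI (filterI PK PL)
      (filterI (nbhs_graph_meet xy xyK) (nbhs_graph_meet zw zwK))).
  have [[x' y'] [Qxy [/= Kx' Ky']]] := QM.
  have [[z' w'] [Qzw [/= Kz' Kw']]] := QN.
  have nzy' := QL _ _ Kz' Ky'.
  apply: (QK _ _ Kx' Kw'); apply: Qg Qxy _ Qzw.
  by split=> //; have [|/nzy'] := Qc y' z'.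
- move=> x y xy.
  have nyx : ~ weak_pref P y x.
    move=> yx; have [Vx [Vy [xV yV gtV]]] := gt_open xy.
    have yxV : nbhs (y, x) (Vy `*` Vx) by exists (Vy, Vx).
    have [Q [[_ _ Qm] [[y' x'] [Qyx [/= Vy' Vx']]]]] :=
      clP _ (nbhs_graph_meet yx yxV).
    by have [_] := Qm _ _ (gtV _ _ Vx' Vy').
  by split=> //; have [|/nyx] := complete x y.
Qed.

(** * Sequential closed convergence *)

Section sequential.
Variables (Pn : nat -> closed_rel X) (P : closed_rel X).
Hypothesis PnP : closed_convergence Pn P.

(** Otherwise a subsequence of [s] lies in the corresponding graphs, and the second clause of closed
    convergence puts its limit [p] in the graph of P. *)
Lemma eventually_not_graph (s : nat -> X * X) p : s @ \oo --> p ->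
  ~ graph P p -> exists N, forall n, (N <= n)%N -> ~ graph (Pn n) (s n).
Proof.
move=> sp nPp; apply: contrapT => /forallNP freq.
have /choice[f fP] : forall N, exists n, (N <= n)%N /\ graph (Pn n) (s n).
  move=> N; have /existsNP[n /not_implyP[Nn /contrapT Pns]] := freq N.
  by exists n.
pose k := fix k j := if j is j'.+1 then f (k j').+1 else f 0%N.
have kmono : {homo k : m n / (m < n)%N}.
  apply: homo_ltn => [|i]; first exact: ltn_trans.
  by have [] := fP (k i).+1.
have kj j : (j <= k j)%N.
  elim: j => // j IH; apply: leq_ltn_trans IH _.
  exact: kmono.
apply: nPp; apply: (PnP.2 k (s \o k)) => //.
  by case=> [|j] /=; [have [] := fP 0%N|have [] := fP (k j).+1].
move=> V /sp[N _ NV]; exists N => // j /= Nj.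
by apply: NV; exact: leq_trans Nj (kj j).
Qed.

Lemma monotone_class_seq_closed :
  (forall n, monotone_class (Pn n)) -> monotone_class P.
Proof.
move=> Pnc.
have complete : is_preference P.
  move=> x y; apply: contrapT => /not_orP[nxy nyx].
  have [N NP] := eventually_not_graph (@cvg_cst _ (x, y) _ \oo _) nxy.
  have [M MP] := eventually_not_graph (@cvg_cst _ (y, x) _ \oo _) nyx.
  have [/(_ x y)] := Pnc (maxn N M).
  by case=> [/(NP _ (leq_maxl _ _))|/(MP _ (leq_maxr _ _))].
have fstP (s : nat -> X * X) (p : X * X) :
    s @ \oo --> p -> (s n).1 @[n --> \oo] --> p.1.
  move=> sp V pV; apply: (sp (fst @^-1` V)).
  by exists (V, setT) => [|q []//]; split=> //; exact: filterT.
have sndP (s : nat -> X * X) (p : X * X) :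
    s @ \oo --> p -> (s n).2 @[n --> \oo] --> p.2.
  move=> sp V pV; apply: (sp (snd @^-1` V)).
  by exists (setT, V) => [|q []//]; split=> //; exact: filterT.
split=> //.
- move=> x y z w xy [yz nzy] zw; apply: contrapT => nxw.
  have [s Ps sxy] := PnP.1 _ xy; have [t Pt tzw] := PnP.1 _ zw.
  (* Recombining the approximations of [(x, y)] and [(z, w)] yields sequences tending to the missing
     pairs [(x, w)] and [(z, y)]. *)
  have xw : ((s n).1, (t n).2) @[n --> \oo] --> ((x, w) : X * X).
    exact: cvg_pair (fstP _ _ sxy) (sndP _ _ tzw).
  have zy : ((t n).1, (s n).2) @[n --> \oo] --> ((z, y) : X * X).
    exact: cvg_pair (fstP _ _ tzw) (sndP _ _ sxy).
  have [N NP] := eventually_not_graph xw nxw.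
  have [M MP] := eventually_not_graph zy nzy.
  have nM := MP _ (leq_maxr N M).
  apply: (NP _ (leq_maxl N M)).
  have [Qc Qg _] := Pnc (maxn N M).
  apply: (Qg _ (s (maxn N M)).2 (t (maxn N M)).1).
  + by have := Ps (maxn N M); case: (s _).
  + by split=> //; have [|/nM] := Qc (s (maxn N M)).2 (t (maxn N M)).1.
  + by have := Pt (maxn N M); case: (t _).
- move=> x y xy.
  have nyx : ~ weak_pref P y x.
    move=> yx; have [Vx [Vy [xV yV gtV]]] := gt_open xy.
    have [s Ps syx] := PnP.1 _ yx.
    have yxV : nbhs (y, x) (Vy `*` Vx) by exists (Vy, Vx).
    have [N _ /(_ N (leqnn N)) [/= Vy' Vx']] := syx _ yxV.
    have [_ _ /(_ _ _ (gtV _ _ Vx' Vy'))[_]] := Pnc N; apply.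
    by have := Ps N; rewrite /weak_pref; case: (s N).
  by split=> //; have [|/nyx] := complete x y.
Qed.

End sequential.

Lemma monotone_class_locally_strict P :
  (forall (x : X) V, nbhs x V -> exists2 x', V x' & gt x' x) ->
  (forall (x : X) V, nbhs x V -> exists2 x', V x' & gt x x') ->
  monotone_class P -> locally_strict P.
Proof.
move=> up down [Pc Pg Pm] x y xy V [[/= Vx Vy] [xV yV] VV].
have [x' Vx' /Pm xx'] := up _ _ xV; have [y' Vy' /Pm yy'] := down _ _ yV.
exists x', y'; split; first exact: VV (x', y') _.
have nyx : ~ weak_pref P y' x'.
  by move=> yx; case: yy' => _; apply; exact: Pg yx xx' xy.
by split=> //; have [|/nyx] := Pc x' y'.
Qed.

End closed_class.

Lemma priors_compact_nbhs (R : realType) (d : nat) (A : priors R d) V :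
  nbhs A V -> exists K, [/\ nbhs A K, compact K & K `<=` V].
Proof.
move=> /nbhs_hausdorffP[e e0 AV]; have [k k0 ck] := compact_hausdorff_ball A.
have e20 : 0 < e / 2 by rewrite divr_gt0.
exists [set B : priors R d | hausdorff_dist A B <= Num.min (e / 2) k]; split.
- apply/nbhs_hausdorffP; exists (Num.min (e / 2) k) => [|B /ltW//].
  by rewrite lt_min e20.
- apply: (subclosed_compact _ ck); first exact: closed_hausdorff_ball.
  by move=> B /=; rewrite le_min => /andP[].
- move=> B /=; rewrite le_min => /andP[AB _]; apply: AV.
  by apply: le_lt_trans AB _; rewrite ltr_pdivrMr// ltr_pMr// ltrDl.
Qed.

Theorem corollary6 (R : realType) (d : nat) (hd : (2 <= d)%N) :
  [/\ locally_compact [set: priors R d],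
      separable (priors R d) &
      completely_metrizable R (priors R d)] /\
  [/\ closed (@grodal_monotone_prefs R d),
      (forall (Pn : nat -> closed_rel (priors R d))
              (P : closed_rel (priors R d)),
         (forall n, grodal_monotone_prefs (Pn n)) ->
         closed_convergence Pn P -> grodal_monotone_prefs P) &
      (forall P : closed_rel (priors R d),
         grodal_monotone_prefs P -> locally_strict P)].
Proof.
have dom_open (A B : priors R d) : support_dominates A B ->
    exists VA VB, [/\ nbhs A VA, nbhs B VB &
      forall A' B', VA A' -> VB B' -> support_dominates A' B'].
  move=> /support_dominates_open[e e0 AB].
  exists [set A' : priors R d | hausdorff_dist A A' < e].
  exists [set B' : priors R d | hausdorff_dist B B' < e].
  by split=> //; apply/nbhs_hausdorffP; exists e.
split; split.
- exact: priors_locally_compact.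
- exact: priors_separable.
- exact: priors_completely_metrizable.
- exact: (monotone_class_closed dom_open (@priors_compact_nbhs R d)).
- by move=> Pn P PnC PnP; exact: (monotone_class_seq_closed dom_open PnP PnC).
- move=> P; apply: monotone_class_locally_strict =>
  A V /nbhs_hausdorffP[e e0 AV].
    by have [B /AV VB BA] := exists_dominating A e0; exists B.
  by have [B /AV VB BA] := exists_dominated A e0; exists B.
Qed.
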